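(* Let $R$ be a ring. If $\varinjlim\mathcal F_1^{\mathrm{fp}}=\mathcal F_1$, then $\mathcal F_1^{\mathrm{fp}}\mathcal F(R)=\mathcal F_1\mathcal F(R)$.
   Context: $R$ is an associative ring with unit and modules are unital. $\mathcal F_1$ is the class of right $R$-modules of flat dimension at most $1$; $\mathcal F_1^{\mathrm{fp}}$ is its subclass of finitely presented modules. A left $R$-module $M$ is $\mathcal F_1$-flat (resp. $\mathcal F_1^{\mathrm{fp}}$-flat) if $\mathrm{Tor}_1^R(H,M)=0$ for every $H\in\mathcal F_1$ (resp. $H\in\mathcal F_1^{\mathrm{fp}}$); the class of all such left modules is denoted $\mathcal F_1\mathcal F(R)$ (resp. $\mathcal F_1^{\mathrm{fp}}\mathcal F(R)$). For a class $\mathcal C$ of right modules, $\varinjlim\mathcal C$ is the class of all modules that are direct limits of direct systems (over directed sets) of modules in $\mathcal C$. *)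

(* Defs.v *)
From HB Require Import structures.
From mathcomp Require Import all_boot all_order all_algebra.
From mathcomp Require Import boolp classical_sets functions cardinality fsbigop.

Set Implicit Arguments.
Unset Strict Implicit.
Unset Printing Implicit Defensive.

Import GRing.Theory.
Local Open Scope ring_scope.
Local Open Scope classical_set_scope.
Local Open Scope quotient_scope.

(* If (r : R^c) *: h is the right action h r, then the axioms of lmodType R^c
   are those of a unital right R-module. *)
Notation rmodType R := (lmodType R^c).

Definition exact (A B C : zmodType) (f : A -> B) (g : B -> C) : Prop :=
  forall y, g y = 0 <-> exists x, f x = y.

Definition onto (A B : Type) (f : A -> B) : Prop := forall y, exists x, f x = y.

Section Kernel.
Variables (U V : zmodType) (f : {additive U -> V}).

Definition ker_pred : {pred U} := fun x => f x == 0.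

Lemma ker_zmod_closed : zmod_closed ker_pred.
Proof.
split=> [|x y]; rewrite !unfold_in ?raddf0 //.
by move=> /eqP fx /eqP fy; rewrite raddfB fx fy subr0.
Qed.

HB.instance Definition _ := GRing.isZmodClosed.Build U ker_pred ker_zmod_closed.

Record ker := Ker { ker_val : U; ker_valP : ker_val \in ker_pred }.

HB.instance Definition _ := [isSub for ker_val].
HB.instance Definition _ := [Choice of ker by <:].
HB.instance Definition _ := [SubChoice_isSubZmodule of ker by <:].

End Kernel.

Section LinearKernel.
Variables (S : pzRingType) (U V : lmodType S) (f : {linear U -> V}).

Lemma ker_subsemimod_closed : subsemimod_closed (ker_pred f).
Proof.
split=> [|a x]; first split=> [|x y]; rewrite !unfold_in ?raddf0 //.
  by move=> /eqP fx /eqP fy; rewrite raddfD fx fy addr0.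
by move=> /eqP fx; rewrite /= linearZ_LR fx scaler0.
Qed.

HB.instance Definition _ :=
  GRing.SubZmodule_isSubLmodule.Build S U (ker_pred f) (ker f)
    ker_subsemimod_closed.

End LinearKernel.

(* The homology ker g / im f; it is used only when g \o f = 0. *)
Section Homology.
Variables (A B C : zmodType) (f : {additive A -> B}) (g : {additive B -> C}).

Definition boundary : {pred ker g} := fun z => `[< exists x, f x = val z >].

Lemma boundary_zmod_closed : zmod_closed boundary.
Proof.
split=> [|z t]; rewrite !unfold_in.
  by apply/asboolP; exists 0; rewrite !raddf0.
move=> /asboolP[x fx] /asboolP[y fy]; apply/asboolP.
by exists (x - y); rewrite !raddfB fx fy.
Qed.

HB.instance Definition _ :=
  GRing.isZmodClosed.Build (ker g) boundary boundary_zmod_closed.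

Definition homology : zmodType := Quotient.quot boundary.

End Homology.

Section FreeModule.
Variables (S : pzRingType) (X : choiceType).

Definition fin_supp : {pred X -> S^o} := fun u => `[< finite_set [set x | u x != 0] >].

Lemma fin_supp_subsemimod_closed : subsemimod_closed fin_supp.
Proof.
split=> [|a u]; first split=> [|u v]; rewrite !unfold_in.
- apply/asboolP; rewrite (_ : mkset _ = set0) //.
  by apply/seteqP; split=> x //=; rewrite eqxx.
- move=> /asboolP fu /asboolP fv; apply/asboolP.
  apply: (@sub_finite_set _ _ ([set x | u x != 0] `|` [set x | v x != 0])).
    move=> x /= uv; case: (eqVneq (u x) 0) => [u0|]; last by left.
    by right; move: uv; rewrite addrfctE u0 add0r.
  by rewrite finite_setU.
- move=> /asboolP fu; apply/asboolP; apply: sub_finite_set fu => x /=.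
  by apply: contra_neq => u0; rewrite scalrfctE u0 scaler0.
Qed.

HB.instance Definition _ :=
  GRing.isSubmodClosed.Build S (X -> S^o) fin_supp fin_supp_subsemimod_closed.

Record free_mod := FreeMod { coef : X -> S^o; coefP : coef \in fin_supp }.

HB.instance Definition _ := [isSub for coef].
HB.instance Definition _ := [Choice of free_mod by <:].
HB.instance Definition _ := [SubChoice_isSubLmodule of free_mod by <:].

End FreeModule.

Section FreeModuleTheory.
Variables (S : pzRingType) (X : choiceType).

Lemma delta_fin_supp (x : X) : (fun y => (y == x)%:R : S^o) \in @fin_supp S X.
Proof.
rewrite unfold_in; apply/asboolP.
apply: (@sub_finite_set _ _ [set x]) => [y /=|]; last exact: finite_set1.
by case: (eqVneq y x) => // _; rewrite eqxx.
Qed.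

Definition free_gen (x : X) : free_mod S X := FreeMod (delta_fin_supp x).

Lemma finite_coef (u : free_mod S X) : finite_set [set x | coef u x != 0].
Proof. by have := coefP u; rewrite unfold_in => /asboolP. Qed.

Section Lift.
Variables (V : lmodType S) (g : X -> V).

Definition free_lift (u : free_mod S X) : V :=
  \sum_(x \in [set: X]) (coef u x : S) *: g x.

Lemma free_lift_fin (A : set X) (u : free_mod S X) :
    finite_set A -> [set x | coef u x != 0] `<=` A ->
  free_lift u = \sum_(x \in A) (coef u x : S) *: g x.
Proof.
move=> finA uA; rewrite /free_lift; apply/esym/fsbig_widen => //= x [_ xA].
apply/eqP; rewrite [X in X *: _](_ : _ = 0) ?scale0r //.
by apply/eqP; apply: contrapT => /negP ux; apply: xA; apply: uA.
Qed.

Lemma free_lift_is_linear : linear free_lift.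
Proof.
move=> a u v.
pose A := [set x | coef u x != 0] `|` [set x | coef v x != 0].
have finA : finite_set A by rewrite finite_setU; split; exact: finite_coef.
have coefE x : coef (a *: u + v) x = a * coef u x + coef v x by [].
rewrite (@free_lift_fin A u) //; last exact: subsetUl.
rewrite (@free_lift_fin A v) //; last exact: subsetUr.
rewrite (@free_lift_fin A) //; last first.
  move=> x h; have {}h : a * coef u x + coef v x != 0 := h.
  have [u0|] := eqVneq (coef u x) 0; last by left.
  by right => /=; apply: contra_neq h => v0; rewrite u0 v0 mulr0 addr0.
rewrite !fsbig_finite //= scaler_sumr -big_split /=.
by apply: eq_bigr => x _; rewrite scalerA -scalerDl.
Qed.

HB.instance Definition _ :=
  GRing.isLinear.Build S (free_mod S X) V _ free_lift free_lift_is_linear.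

Lemma free_lift_gen (x : X) : free_lift (free_gen x) = g x.
Proof.
have sub : [set y | coef (free_gen x) y != 0] `<=` [set x].
  by move=> y /=; case: (eqVneq y x) => // _; rewrite eqxx.
by rewrite (free_lift_fin (finite_set1 x) sub) fsbig_set1 /= eqxx scale1r.
Qed.

End Lift.
End FreeModuleTheory.

Section Span.
Variables (V : zmodType) (A : set V).

Definition zspan : {pred V} :=
  fun x => `[< forall T : zmodClosed V, (forall y, A y -> y \in T) -> x \in T >].

Lemma zspan_zmod_closed : zmod_closed zspan.
Proof.
split=> [|x y]; rewrite !unfold_in.
  by apply/asboolP => T _; exact: rpred0.
move=> /asboolP xT /asboolP yT; apply/asboolP => T AT.
by apply: rpredB; [exact: xT | exact: yT].
Qed.

HB.instance Definition _ := GRing.isZmodClosed.Build V zspan zspan_zmod_closed.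

Lemma mem_zspan x : A x -> x \in zspan.
Proof. by move=> Ax; apply/asboolP => T; exact. Qed.

End Span.

Section Tensor.
Variables (R : pzRingType) (H : rmodType R) (M : lmodType R).

Definition pair_gen (h : H) (m : M) : free_mod int (H * M)%type :=
  free_gen int (h, m).

Inductive tensor_rel : set (free_mod int (H * M)%type) :=
| tensor_relDl h h' m :
    tensor_rel (pair_gen (h + h') m - pair_gen h m - pair_gen h' m)
| tensor_relDr h m m' :
    tensor_rel (pair_gen h (m + m') - pair_gen h m - pair_gen h m')
| tensor_relZ h (r : R) m :
    tensor_rel (pair_gen ((r : R^c) *: h) m - pair_gen h (r *: m)).

Definition tensor : zmodType := Quotient.quot (zspan tensor_rel).

Definition pure_tensor (h : H) (m : M) : tensor := \pi_(tensor) (pair_gen h m).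

End Tensor.

Section TensorMap.
Variables (R : pzRingType) (H H' : rmodType R) (M M' : lmodType R).
Variables (f : {linear H -> H'}) (g : {linear M -> M'}).

Definition pair_map : free_mod int (H * M)%type -> free_mod int (H' * M')%type :=
  free_lift (fun p => free_gen int (f p.1, g p.2)).

HB.instance Definition _ := GRing.Linear.on pair_map.

Definition tensor_map (t : tensor H M) : tensor H' M' :=
  \pi_(tensor H' M') (pair_map (repr t)).

Lemma pair_map_rel u :
  u \in zspan (@tensor_rel R H M) -> pair_map u \in zspan (@tensor_rel R H' M').
Proof.
pose P : {pred free_mod int (H * M)%type} :=
  fun v => pair_map v \in zspan (@tensor_rel R H' M').
have PE x : (x \in P) = (pair_map x \in zspan (@tensor_rel R H' M')) by [].
have Pz : zmod_closed P.
  split=> [|x y]; rewrite !PE ?raddf0 ?rpred0 // => Px Py.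
  by rewrite raddfB; exact: rpredB.
pose PC := GRing.isZmodClosed.Build _ P Pz.
pose PZ : zmodClosed _ := HB.pack P PC.
have genE h m : pair_map (pair_gen h m) = pair_gen (f h) (g m).
  exact: free_lift_gen.
have mapB v w : pair_map (v - w) = pair_map v - pair_map w by exact: raddfB.
move=> /asboolP /(_ PZ); apply=> v; case=> [h h' m|h m m'|h r m].
- rewrite PE !mapB !genE (raddfD f).
  by apply: mem_zspan; exact: tensor_relDl.
- rewrite PE !mapB !genE (raddfD g).
  by apply: mem_zspan; exact: tensor_relDr.
- rewrite PE !mapB !genE (linearZ_LR f) (linearZ_LR g).
  by apply: mem_zspan; exact: tensor_relZ.
Qed.

Lemma tensor_map_pi u :
  tensor_map (\pi_(tensor H M) u) = \pi_(tensor H' M') (pair_map u).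
Proof.
apply/eqP; rewrite -Quotient.idealrBE -raddfB; apply: pair_map_rel.
by rewrite Quotient.idealrBE reprK.
Qed.

Lemma tensor_map_pure h m :
  tensor_map (pure_tensor h m) = pure_tensor (f h) (g m).
Proof. by rewrite tensor_map_pi /pair_map free_lift_gen. Qed.

Lemma tensor_map_is_zmod_morphism : zmod_morphism tensor_map.
Proof.
move=> s t; rewrite -[s]reprK -[t]reprK -raddfB !tensor_map_pi.
by rewrite raddfB raddfB.
Qed.

HB.instance Definition _ :=
  GRing.isZmodMorphism.Build (tensor H M) (tensor H' M') tensor_map
    tensor_map_is_zmod_morphism.

End TensorMap.

Section FreeResolution.
Variables (S : pzRingType).

Definition free_cover (V : lmodType S) : {linear free_mod S V -> V} :=
  free_lift (fun v : V => v).

(* The free resolution ... -> res_mod 1 -> res_mod 0 -> H -> 0 of H in which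
   each syzygy is covered by the free module on its underlying set. *)
Fixpoint syzygy (H : lmodType S) (n : nat) : lmodType S :=
  if n is m.+1 then ker (free_cover (syzygy H m)) else H.

Definition res_mod (H : lmodType S) (n : nat) : lmodType S :=
  free_mod S (syzygy H n).

Definition res_diff (H : lmodType S) (n : nat) :
    {linear res_mod H n.+1 -> res_mod H n} :=
  (val : ker (free_cover (syzygy H n)) -> free_mod S (syzygy H n))
    \o free_cover (syzygy H n.+1).

Lemma free_cover_onto (V : lmodType S) : onto (free_cover V).
Proof. by move=> v; exists (free_gen S v); exact: free_lift_gen. Qed.

Lemma res_diff_exact0 (H : lmodType S) : exact (res_diff H 0) (free_cover H).
Proof.
move=> y; split=> [y0|[x <-]]; last exact/eqP/(valP (free_cover _ x)).
have yker : y \in ker_pred (free_cover H) by apply/eqP.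
have [x xE] := free_cover_onto (Ker yker : syzygy H 1).
by exists x; rewrite /= xE.
Qed.

Lemma res_diff_exact (H : lmodType S) (n : nat) :
  exact (res_diff H n.+1) (res_diff H n).
Proof.
move=> y; split=> [y0|[x <-]].
  have yker : y \in ker_pred (free_cover (syzygy H n.+1)).
    by apply/eqP/val_inj; exact: y0.
  have [x xE] := free_cover_onto (Ker yker : syzygy H n.+2).
  by exists x; rewrite /= xE.
have /eqP h := valP (free_cover (syzygy H n.+2) x).
by rewrite /= h.
Qed.

End FreeResolution.

Section Tor.
Variables (R : pzRingType) (H : rmodType R) (M : lmodType R).

Definition Tor (n : nat) : zmodType :=
  match n with
  | 0 => homology (tensor_map (res_diff H 0) (@idfun M))
           (\0 : tensor (res_mod H 0) M -> tensor (res_mod H 0) M)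
  | m.+1 => homology (tensor_map (res_diff H m.+1) (@idfun M))
              (tensor_map (res_diff H m) (@idfun M))
  end.

End Tor.

Section Classes.
Variables (R : pzRingType).
Implicit Types (H F : rmodType R) (M : lmodType R).

Definition flat F : Prop :=
  forall (M1 M2 M3 : lmodType R) (f : {linear M1 -> M2}) (g : {linear M2 -> M3}),
  exact f g -> exact (tensor_map (@idfun F) f) (tensor_map (@idfun F) g).

Definition flat_dim_le (n : nat) H : Prop :=
  exists (F : nat -> rmodType R) (d : forall i, {linear F i.+1 -> F i})
         (e : {linear F 0 -> H}),
  [/\ forall i, flat (F i),
      forall i, (n < i)%N -> forall x : F i, x = 0,
      onto e, exact (d 0) e & forall i, exact (d i.+1) (d i)].

Definition fin_pres (S : pzRingType) (V : lmodType S) : Prop :=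
  exists (m n : nat) (f : {linear 'rV[S]_m -> 'rV[S]_n}) (g : {linear 'rV[S]_n -> V}),
  exact f g /\ onto g.

Definition F1 H : Prop := flat_dim_le 1 H.

Definition F1fp H : Prop := F1 H /\ fin_pres H.

Definition Tor1_orth (C : rmodType R -> Prop) M : Prop :=
  forall H, C H -> forall x : Tor H M 1, x = 0.

Definition F1F : lmodType R -> Prop := Tor1_orth F1.

Definition F1fpF : lmodType R -> Prop := Tor1_orth F1fp.

End Classes.

Section DirectLimit.
Variables (S : pzRingType) (d : Order.disp_t) (I : preorderType d).

Definition directed : Prop :=
  inhabited I /\ forall i j : I, exists k : I, (i <= k)%O /\ (j <= k)%O.

Variables (V : I -> lmodType S)
  (t : forall i j : I, (i <= j)%O -> {linear V i -> V j}).

Definition direct_system : Prop :=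
  (forall i (le_ii : (i <= i)%O) x, t le_ii x = x) /\
  (forall i j k (le_ij : (i <= j)%O) (le_jk : (j <= k)%O) (le_ik : (i <= k)%O) x,
     t le_jk (t le_ij x) = t le_ik x).

Definition cocone (W : lmodType S) (h : forall i, {linear V i -> W}) : Prop :=
  forall i j (le_ij : (i <= j)%O) x, h j (t le_ij x) = h i x.

Definition is_direct_limit (L : lmodType S) (h : forall i, {linear V i -> L}) :
    Prop :=
  cocone h /\
  forall (W : lmodType S) (k : forall i, {linear V i -> W}), cocone k ->
    (exists u : {linear L -> W}, forall i x, u (h i x) = k i x) /\
    (forall u v : {linear L -> W},
       (forall i x, u (h i x) = k i x) -> (forall i x, v (h i x) = k i x) ->
       u =1 v).

End DirectLimit.

Definition lim_class (S : pzRingType) (C : lmodType S -> Prop) (L : lmodType S) :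
    Prop :=
  exists (d : Order.disp_t) (I : preorderType d) (V : I -> lmodType S)
         (t : forall i j : I, (i <= j)%O -> {linear V i -> V j})
         (h : forall i, {linear V i -> L}),
  [/\ directed I, forall i, C (V i), direct_system t & is_direct_limit t h].

(* Main.v *)
(* Tor commutes with direct limits, so vanishing of Tor_1(-, M) on F_1^fp passes
   to the direct limits of such modules, that is to F_1. In terms of elements:
   if L is the direct limit of the V i, then every element of L comes from some
   V i, and two elements of V i with the same image in L already agree in some
   V j. This property passes to free modules, kernels and tensor products, hence
   to the complexes that compute Tor, as the free resolution is functorial. So a
   cycle over L lifts to a cycle over some V j, which is a boundary there. *)
Require Import Defs.
From HB Require Import structures.
From mathcomp Require Import all_boot all_order all_algebra.
From mathcomp Require Import boolp classical_sets cardinality fsbigop.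

Set Implicit Arguments.
Unset Strict Implicit.
Unset Printing Implicit Defensive.

Import Order.Theory GRing.Theory.
Local Open Scope ring_scope.
Local Open Scope classical_set_scope.
Local Open Scope quotient_scope.

(** * Functoriality of free modules *)

Section FreeMap.
Variable S : pzRingType.

(** Agreement is asked only on the support of [u], a finite set; this is what makes finite
    separation arguments possible later. *)
Lemma eq_free_lift (X : choiceType) (V : lmodType S) (g g' : X -> V)
    (u : free_mod S X) :
  (forall x, coef u x != 0 -> g x = g' x) -> free_lift g u = free_lift g' u.
Proof.
move=> gg'.
rewrite !(free_lift_fin _ (finite_coef u)) //.
by apply: eq_fsbigr => x; rewrite inE /= => /gg' ->.
Qed.

Lemma free_lift_free_gen (X : choiceType) (u : free_mod S X) :
  free_lift (@free_gen S X) u = u.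
Proof.
apply: val_inj; apply/funext => y.
rewrite (free_lift_fin _ (finite_coef u)) // fsbig_finite /=;
  last exact: finite_coef.
(* Evaluation at [y] moves inside the finite sum, where only the index [x = y] can contribute. *)
transitivity (\sum_(x <- finmap.enum_fset (fset_set (fun x => coef u x != 0)))
   coef u x * (y == x)%:R).
  elim: (finmap.enum_fset _) => [|x s IHs]; first by rewrite !big_nil.
  by rewrite !big_cons -IHs.
have [uy0|uy0] := eqVneq (coef u y) 0.
  rewrite uy0 big1 // => x _; case: eqP => [<-|]; last by rewrite mulr0.
  by rewrite uy0 mul0r.
rewrite (bigD1_seq y) ?finmap.fset_uniq //=; last first.
  by rewrite in_fset_set; [apply/mem_set | exact: finite_coef].
rewrite eqxx mulr1 big1 ?addr0 // => x /negPf.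
by rewrite eq_sym => ->; rewrite mulr0.
Qed.

Lemma free_mod_ind (X : choiceType) (P : free_mod S X -> Prop) :
    P 0 -> (forall u v, P u -> P v -> P (u + v)) ->
    (forall a x, P (a *: free_gen S x)) ->
  forall u, P u.
Proof.
move=> P0 PD Pg u; rewrite -[u]free_lift_free_gen.
rewrite (free_lift_fin _ (finite_coef u)) // fsbig_finite /=;
  last exact: finite_coef.
by apply: big_ind => // x _; apply: Pg.
Qed.

Lemma free_mod_linear_ext (X : choiceType) (V : lmodType S)
    (f g : {linear free_mod S X -> V}) :
  (forall x, f (free_gen S x) = g (free_gen S x)) -> f =1 g.
Proof.
move=> fg; apply: free_mod_ind => [|u v fu fv|a x]; first by rewrite !raddf0.
  by rewrite (raddfD f) (raddfD g); congr (_ + _).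
by rewrite (linearZ_LR f) (linearZ_LR g); congr (_ *: _).
Qed.

Definition free_map (X Y : choiceType) (f : X -> Y) :
    {linear free_mod S X -> free_mod S Y} :=
  free_lift (fun x => free_gen S (f x)).

Lemma free_map_gen (X Y : choiceType) (f : X -> Y) x :
  free_map f (free_gen S x) = free_gen S (f x).
Proof. exact: free_lift_gen. Qed.

Lemma free_map_comp (X Y Z : choiceType) (f : X -> Y) (g : Y -> Z) u :
  free_map g (free_map f u) = free_map (g \o f) u.
Proof.
move: u; apply: (@free_mod_linear_ext _ _ (free_map g \o free_map f)) => x /=.
by rewrite !free_map_gen.
Qed.

Lemma eq_free_map (X Y : choiceType) (f g : X -> Y) (u : free_mod S X) :
  (forall x, coef u x != 0 -> f x = g x) -> free_map f u = free_map g u.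
Proof. by move=> fg; apply: eq_free_lift => x /fg ->. Qed.

Lemma free_cover_map (V W : lmodType S) (f : {linear V -> W}) u :
  free_cover W (free_map f u) = f (free_cover V u).
Proof.
move: u.
apply: (@free_mod_linear_ext _ _ (free_cover W \o free_map f)
  (f \o free_cover V)).
by move=> x /=; rewrite free_map_gen /free_cover !free_lift_gen.
Qed.

End FreeMap.

(** * Functoriality of kernels, syzygies and the free resolution *)

Section SyzygyMap.
Variables (S : pzRingType).

Section KerMap.
Variables (U V U' V' : lmodType S).
Variables (a : {linear U -> V}) (b : {linear U' -> V'}).
Variables (f : {linear U -> U'}) (g : {linear V -> V'}).
Hypothesis sq : forall x, b (f x) = g (a x).

Lemma ker_map_subproof (x : ker a) : f (val x) \in ker_pred b.
Proof.
apply/eqP; apply: etrans (sq _) _.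
by have /eqP -> := valP x; rewrite raddf0.
Qed.

Definition ker_map (x : ker a) : ker b := Ker (ker_map_subproof x).

Lemma ker_map_is_linear : linear ker_map.
Proof. by move=> c x y; apply: val_inj; rewrite /= linearP. Qed.

HB.instance Definition _ :=
  GRing.isLinear.Build S _ _ _ ker_map ker_map_is_linear.

End KerMap.

(** Covering each syzygy by the free module on its underlying set is natural, so [f] restricts to
    kernels at every level without any choice of lifts. *)
Fixpoint syz_map (V W : lmodType S) (f : {linear V -> W}) (n : nat) :
    {linear syzygy V n -> syzygy W n} :=
  if n is m.+1 then ker_map (free_cover_map (syz_map f m)) else f.

Definition res_map (V W : lmodType S) (f : {linear V -> W}) (n : nat) :
    {linear res_mod V n -> res_mod W n} := free_map S (syz_map f n).

Lemma res_map_diff (V W : lmodType S) (f : {linear V -> W}) n x :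
  res_map f n (res_diff V n x) = res_diff W n (res_map f n.+1 x).
Proof. by rewrite /res_diff /= /res_map free_cover_map. Qed.

End SyzygyMap.

(** * Tensor maps computed on representatives in free abelian groups *)

Section TensorMapFree.
Variables (R : pzRingType) (M : lmodType R).

(** Acts on the generators behind the tensor product, so that [tensor_map f idfun] is induced by a
    [free_map]. *)
Definition pair_fst (U V : rmodType R) (f : U -> V) (p : U * M) : V * M :=
  (f p.1, p.2).

Lemma tensorE (U : rmodType R) (x : tensor U M) :
  exists u : free_mod int (U * M)%type, x = \pi_(tensor U M) u.
Proof. by exists (repr x); rewrite reprK. Qed.

Lemma tensor_map_free (U V : rmodType R) (f : {linear U -> V})
    (u : free_mod int (U * M)%type) :
  tensor_map f (@idfun M) (\pi_(tensor U M) u) =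
  \pi_(tensor V M) (free_map int (pair_fst f) u).
Proof. exact: tensor_map_pi. Qed.

Lemma pair_fst_rel (U V : rmodType R) (f : {linear U -> V})
    (u : free_mod int (U * M)%type) :
  u \in zspan (@tensor_rel R U M) ->
  free_map int (pair_fst f) u \in zspan (@tensor_rel R V M).
Proof. exact: (pair_map_rel f (@idfun M)). Qed.

Lemma tensor_map_comp (U V W : rmodType R) (f : {linear U -> V})
    (g : {linear V -> W}) (k : {linear U -> W}) (x : tensor U M) :
    (forall y, g (f y) = k y) ->
  tensor_map g (@idfun M) (tensor_map f (@idfun M) x) =
  tensor_map k (@idfun M) x.
Proof.
move=> gf; have [u ->] := tensorE x.
rewrite 3!tensor_map_free free_map_comp.
suff -> : pair_fst g \o pair_fst f = pair_fst k by [].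
by apply/funext => p; rewrite /pair_fst /= gf.
Qed.

End TensorMapFree.

(** * Filtered colimits in terms of elements; free modules and syzygies *)

Section FilteredColimit.
Variables (d : Order.disp_t) (I : preorderType d).
Hypothesis dirI : directed I.

(** Stated for bare types and functions, so that one notion serves modules, sets of generators, free
    modules and tensor products alike. *)
Definition filtered_colimit (X : I -> Type)
    (t : forall i j, (i <= j)%O -> X i -> X j) (L : Type)
    (h : forall i, X i -> L) : Prop :=
  [/\ forall i j k (ij : (i <= j)%O) (jk : (j <= k)%O) (ik : (i <= k)%O) x,
        t _ _ jk (t _ _ ij x) = t _ _ ik x,
      forall i j (ij : (i <= j)%O) x, h j (t _ _ ij x) = h i x,
      forall l, exists i x, h i x = l
    & forall i (x y : X i), h i x = h i y ->
        exists j (ij : (i <= j)%O), t _ _ ij x = t _ _ ij y].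

Section Transition.
Variables (X : I -> choiceType) (t : forall i j, (i <= j)%O -> X i -> X j).
Variables (L : Type) (h : forall i, X i -> L).
Hypothesis colim : filtered_colimit t h.

Lemma colimit_lift2 (l l' : L) :
  exists i (x x' : X i), h x = l /\ h x' = l'.
Proof.
have [_ ht hs _] := colim.
have [i [x <-]] := hs l; have [j [y <-]] := hs l'.
have [k [ik jk]] := dirI.2 i j.
by exists k, (t ik x), (t jk y); rewrite !ht.
Qed.

(** Each coincidence in the limit appears at some stage, and directedness gives one stage beyond
    finitely many of these. *)
Lemma colimit_separate (i : I) (s : seq (X i * X i)) :
  exists j (ij : (i <= j)%O),
    forall p, p \in s -> h p.1 = h p.2 -> t ij p.1 = t ij p.2.
Proof.
have [tt ht hs hi] := colim.
elim: s => [|q s [j [ij IHs]]]; first by exists i, (lexx i).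
have [hq|hq] := pselect (h q.1 = h q.2); last first.
  by exists j, ij => p; rewrite inE => /predU1P[-> //|]; exact: IHs.
have [k [ik tk]] := hi _ _ _ hq.
have [m [jm km]] := dirI.2 j k.
have im := le_trans ij jm; exists m, im => p.
rewrite inE => /predU1P[-> _|ps hp].
  by rewrite -(tt _ _ _ ik km) tk tt.
by rewrite -(tt _ _ _ ij jm) (IHs _ ps hp) tt.
Qed.

End Transition.

(** An element of a free module involves finitely many generators, so it lifts to one stage, and all
    coincidences among the generators of two elements occur together at a later one. The stages are
    groups so that [0] can serve as a default value in the proof. *)
Lemma filtered_colimit_free (S : pzRingType) (X : I -> zmodType)
    (t : forall i j, (i <= j)%O -> X i -> X j) (L : zmodType)
    (h : forall i, X i -> L) :
  filtered_colimit t h ->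
  filtered_colimit (X := fun i => free_mod S (X i))
    (fun i j ij => free_map S (t i j ij)) (fun i => free_map S (h i)).
Proof.
move=> colim; have [tt ht hs hi] := colim; split.
- move=> i j k ij jk ik u; rewrite free_map_comp.
  by apply: eq_free_map => x _ /=; exact: tt.
- move=> i j ij u; rewrite free_map_comp.
  by apply: eq_free_map => x _ /=; exact: ht.
- apply: free_mod_ind => [|u v [i [x <-]] [j [y <-]]|a x].
  + by have [[i] _] := dirI; exists i, 0; rewrite raddf0.
  + have [k [ik jk]] := dirI.2 i j.
    exists k, (free_map S (t _ _ ik) x + free_map S (t _ _ jk) y).
    rewrite (raddfD (free_map S (h k))).
    by congr (_ + _); apply: etrans (free_map_comp _ _ _) _;
      apply: eq_free_map => z _ /=; exact: ht.
  + have [i [y <-]] := hs x; exists i, (a *: free_gen S y).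
    by rewrite linearZ_LR free_map_gen.
- move=> i u v huv.
  have /finite_seqP[s sE] :
      finite_set ([set x | coef u x != 0] `|` [set x | coef v x != 0]).
    by rewrite finite_setU; split; exact: finite_coef.
  have [j [ij sep]] :=
    @colimit_separate (fun i => X i) _ _ _ colim i
      [seq (x, y) | x <- s, y <- s].
  (* The transition map agrees on the two supports with a function of the
     image in the limit, through which both sides can be computed. *)
  pose r (l : L) : X j :=
    if pselect (exists x, x \in s /\ h i x = l) is left e
    then t i j ij (projT1 (cid e)) else 0.
  have rE x : x \in s -> t i j ij x = r (h i x).
    move=> xs; rewrite /r; case: pselect => [e|[]]; last by exists x.
    case: (cid e) => y [ys hy] /=; apply: (sep (x, y)); last by [].
    exact: allpairs_f.
  exists j, ij.
  have uE : free_map S (t i j ij) u = free_map S r (free_map S (h i) u).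
    rewrite free_map_comp; apply: eq_free_map => x ux; apply: rE.
    by have : [set` s] x by rewrite -sE; left.
  have vE : free_map S (t i j ij) v = free_map S r (free_map S (h i) v).
    rewrite free_map_comp; apply: eq_free_map => x ux; apply: rE.
    by have : [set` s] x by rewrite -sE; right.
  by rewrite uE vE huv.
Qed.

Section Syzygy.
Variables (S : pzRingType) (V : I -> lmodType S) (L : lmodType S).
Variables (t : forall i j, (i <= j)%O -> {linear V i -> V j}).
Variable (h : forall i, {linear V i -> L}).
Hypothesis colim : filtered_colimit t h.

(** Separation is inherited from the ambient free module. To lift an element of the kernel, lift it
    to the free module first: its image under the cover dies in the limit, hence at a later stage,
    where the lift enters the kernel. *)
Lemma filtered_colimit_syz n :
  filtered_colimit (X := fun i => syzygy (V i) n)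
    (fun i j ij => syz_map (t ij) n) (fun i => syz_map (h i) n).
Proof.
elim: n => [//|n IHn].
have [tt ht hs hi] := filtered_colimit_free S IHn.
have [_ ht0 _ hi0] := IHn.
split=> [i j k ij jk ik x|i j ij x|[l lker]|i x y /(congr1 val)/hi[j [ij txy]]].
- exact/val_inj/tt.
- exact/val_inj/ht.
- have [i [u hu]] := hs l.
  have h0 : syz_map (h i) n (free_cover _ u) = syz_map (h i) n 0.
    by rewrite -free_cover_map hu (eqP lker) raddf0.
  have [j [ij tu]] := hi0 _ _ _ h0.
  have uker : free_map S (syz_map (t ij) n) u \in
      ker_pred (free_cover (syzygy (V j) n)).
    by apply/eqP; apply: etrans (free_cover_map _ _) _; rewrite tu raddf0.
  exists j, (Ker uker); apply: val_inj; exact: (etrans (ht i j ij u) hu).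
- by exists j, ij; apply: val_inj.
Qed.

Lemma filtered_colimit_res n :
  filtered_colimit (X := fun i => res_mod (V i) n)
    (fun i j ij => res_map (t ij) n) (fun i => res_map (h i) n).
Proof. exact: filtered_colimit_free (filtered_colimit_syz n). Qed.

End Syzygy.
End FilteredColimit.

(** * Tensor products with a fixed module preserve filtered colimits *)

Lemma zspan_ind (V : zmodType) (A : set V) (P : V -> Prop) :
    P 0 -> (forall x y, P x -> P y -> P (x - y)) -> (forall x, A x -> P x) ->
  forall x, x \in zspan A -> P x.
Proof.
move=> P0 PB PA x.
pose Q : {pred V} := fun y => `[< P y >].
have Qz : zmod_closed Q.
  split=> [|y z]; rewrite !unfold_in; first exact/asboolP.
  by move=> /asboolP Py /asboolP Pz; apply/asboolP; exact: PB.
pose QC := GRing.isZmodClosed.Build _ Q Qz.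
pose QZ : zmodClosed V := HB.pack Q QC.
by move=> /asboolP /(_ QZ) => QX; apply/asboolP/QX => y Ay; apply/asboolP/PA.
Qed.

Section TensorColimit.
Variables (d : Order.disp_t) (I : preorderType d).
Hypothesis dirI : directed I.
Variables (R : pzRingType) (M : lmodType R).
Variables (V : I -> rmodType R) (L : rmodType R).
Variables (t : forall i j, (i <= j)%O -> {linear V i -> V j}).
Variable (h : forall i, {linear V i -> L}).
Hypothesis colim : filtered_colimit t h.

Lemma filtered_colimit_pair :
  filtered_colimit (X := fun i => (V i * M)%type)
    (fun i j ij => pair_fst (M := M) (t ij)) (fun i => pair_fst (M := M) (h i)).
Proof.
have [tt ht hs hi] := colim; split.
- by move=> i j k ij jk ik [x m]; congr (_, _); exact: tt.
- by move=> i j ij [x m]; congr (_, _); exact: ht.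
- by move=> [l m]; have [i [x <-]] := hs l; exists i, (x, m).
- move=> i [x m] [y n] [/hi[j [ij txy]] /= <-]; exists j, ij.
  by congr (_, _).
Qed.

(** The pairs are mere generators here; the product group structure is supplied because
    [filtered_colimit_free] takes groups. *)
Let free_colim :=
  filtered_colimit_free (X := fun i => (V i * M)%type : zmodType)
    (L := (L * M)%type : zmodType) dirI int filtered_colimit_pair.

(** A defining relation involves at most two elements of [L]; they lift to a common stage, where the
    same relation can be written down. *)
Lemma tensor_rel_lift w : w \in zspan (@tensor_rel R L M) ->
  exists i (u : free_mod int (V i * M)%type),
    u \in zspan (@tensor_rel R (V i) M) /\ free_map int (pair_fst (h i)) u = w.
Proof.
have [tt ht hs hi] := free_colim; have [i0] := dirI.1.
have genE i x (m : M) :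
    free_map int (pair_fst (h i)) (pair_gen x m) = pair_gen (h i x) m.
  exact: free_map_gen.
move: w; apply: zspan_ind => [|w w' [i [u [uz <-]]] [j [v [vz <-]]]|w].
- by exists i0, 0; rewrite raddf0 rpred0.
- have [k [ik jk]] := dirI.2 i j.
  exists k.
  exists (free_map int (pair_fst (t ik)) u - free_map int (pair_fst (t jk)) v).
  split; first by apply: rpredB; exact: pair_fst_rel.
  by rewrite (raddfB (free_map int (pair_fst (h k)))); congr (_ - _); exact: ht.
- case=> [l l' m|l m m'|l r m].
  + have [i [x [x' [<- <-]]]] := colimit_lift2 dirI colim l l'.
    exists i, (pair_gen (x + x') m - pair_gen x m - pair_gen x' m).
    split; first by apply: mem_zspan; exact: tensor_relDl.
    rewrite (raddfB (free_map int (pair_fst (h i)))).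
    rewrite (raddfB (free_map int (pair_fst (h i)))).
    by congr (_ - _ - _); apply: etrans (genE _ _ _) _; rewrite ?raddfD.
  + have [_ _ hs0 _] := colim; have [i [x <-]] := hs0 l.
    exists i, (pair_gen x (m + m') - pair_gen x m - pair_gen x m').
    split; first by apply: mem_zspan; exact: tensor_relDr.
    rewrite (raddfB (free_map int (pair_fst (h i)))).
    rewrite (raddfB (free_map int (pair_fst (h i)))).
    by congr (_ - _ - _); apply: etrans (genE _ _ _) _.
  + have [_ _ hs0 _] := colim; have [i [x <-]] := hs0 l.
    exists i, (pair_gen ((r : R^c) *: x) m - pair_gen x (r *: m)).
    split; first by apply: mem_zspan; exact: tensor_relZ.
    rewrite (raddfB (free_map int (pair_fst (h i)))).
    by congr (_ - _); apply: etrans (genE _ _ _) _; rewrite ?linearZ_LR.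
Qed.

Lemma filtered_colimit_tensor :
  filtered_colimit (X := fun i => tensor (V i) M)
    (fun i j ij => tensor_map (t ij) (@idfun M))
    (fun i => tensor_map (h i) (@idfun M)).
Proof.
have [tt0 ht0 _ _] := colim; have [tt ht hs hi] := free_colim; split.
- by move=> i j k ij jk ik x; apply: tensor_map_comp => y; exact: tt0.
- by move=> i j ij x; apply: tensor_map_comp => y; exact: ht0.
- move=> x; have [u ->] := tensorE x; have [i [v <-]] := hs u.
  by exists i, (\pi_(tensor (V i) M) v); rewrite tensor_map_free.
- move=> i x y; have [u ->] := tensorE x; have [v ->] := tensorE y.
  rewrite !tensor_map_free => /eqP; rewrite -Quotient.idealrBE => uv.
  (* The difference [u - v] and the lifted relation [w] have the same image in the free group over
     the limit, so they agree at some stage [n]; there the difference is itself a relation. *)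
  have {uv} [k [w [wz wE]]] := tensor_rel_lift uv.
  have [m [im km]] := dirI.2 i k.
  have : free_map int (pair_fst (h m))
           (free_map int (pair_fst (t im)) (u - v)) =
         free_map int (pair_fst (h m))
           (free_map int (pair_fst (t km)) w).
    apply: etrans (ht _ _ _ _) _; apply: etrans _ (esym (ht _ _ _ _)).
    by rewrite wE; exact: raddfB.
  move=> /hi[n [mn]].
  have i_n := le_trans im mn; have kn := le_trans km mn.
  move=> /(etrans (esym (tt _ _ _ im mn i_n _))).
  move=> /esym/(etrans (esym (tt _ _ _ km mn kn _))) tuv.
  exists n, i_n; rewrite !tensor_map_free; apply/eqP.
  rewrite -Quotient.idealrBE.
  have <- := raddfB (free_map int (pair_fst (t i_n))) u v.
  by rewrite -[X in X \in _]tuv; exact: pair_fst_rel.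
Qed.

End TensorColimit.

(** * Vanishing of Tor in the limit *)

Lemma homology_eq0 (A B C : zmodType) (f : {additive A -> B})
    (g : {additive B -> C}) :
  (forall x : homology f g, x = 0) <->
  (forall z, g z = 0 -> exists y, f y = z).
Proof.
split=> [H0 z gz|bd x].
  have zker : z \in ker_pred g by apply/eqP.
  (* Equality in the quotient is membership of a difference, hence the [- 0]. *)
  have : Ker zker - 0 \in @boundary _ _ _ f g.
    rewrite Quotient.idealrBE; apply/eqP.
    exact: etrans (H0 _) (esym (H0 _)).
  by rewrite subr0 => /asboolP.
suff : repr x - 0 \in @boundary _ _ _ f g.
  rewrite Quotient.idealrBE => /eqP; rewrite reprK => ->; exact: raddf0.
by rewrite subr0; apply/asboolP/bd/eqP; exact: (ker_valP (repr x)).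
Qed.

Section TorColimit.
Variables (d : Order.disp_t) (I : preorderType d).
Hypothesis dirI : directed I.
Variables (R : pzRingType) (M : lmodType R).
Variables (V : I -> rmodType R) (L : rmodType R).
Variables (t : forall i j, (i <= j)%O -> {linear V i -> V j}).
Variable (h : forall i, {linear V i -> L}).
Hypothesis colim : filtered_colimit t h.

Lemma Tor_eq0 (H : rmodType R) n :
  (forall x : Tor H M n.+1, x = 0) <->
  (forall z, tensor_map (res_diff H n) (@idfun M) z = 0 ->
     exists y, tensor_map (res_diff H n.+1) (@idfun M) y = z).
Proof. exact: homology_eq0. Qed.

Lemma tensor_res_map_diff (H H' : rmodType R) (f : {linear H -> H'}) n
    (x : tensor (res_mod H n.+1) M) :
  tensor_map (res_map f n) (@idfun M) (tensor_map (res_diff H n) (@idfun M) x) =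
  tensor_map (res_diff H' n) (@idfun M)
    (tensor_map (res_map f n.+1) (@idfun M) x).
Proof.
rewrite (@tensor_map_comp _ _ _ _ _ _ _ (res_map f n \o res_diff H n)) //.
by apply/esym/tensor_map_comp => y; rewrite -res_map_diff.
Qed.

Lemma Tor_colimit_eq0 n :
    (forall i (x : Tor (V i) M n.+1), x = 0) ->
  forall x : Tor L M n.+1, x = 0.
Proof.
move=> T0; apply/Tor_eq0 => z.
have tensor_colim k :=
  filtered_colimit_tensor dirI M (filtered_colimit_res dirI colim k).
have [_ ht hs _] := tensor_colim n.+1; have [_ _ _ hi] := tensor_colim n.
move=> z0; have [i [y hy]] := hs z.
(* The lift [y] of the cycle [z] need not be a cycle, but its differential dies in the limit, hence
   at a stage [j]; the image of [y] there is a cycle. *)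
have : tensor_map (res_map (h i) n) (@idfun M)
         (tensor_map (res_diff (V i) n) (@idfun M) y) =
       tensor_map (res_map (h i) n) (@idfun M) 0.
  by rewrite tensor_res_map_diff hy z0 raddf0.
move=> /hi[j [ij]]; rewrite tensor_res_map_diff raddf0.
move=> /(Tor_eq0 _ _).1 -/(_ (T0 j))[w wE].
exists (tensor_map (res_map (h j) n.+2) (@idfun M) w).
by rewrite -tensor_res_map_diff wE -hy; exact: ht.
Qed.

End TorColimit.

(** * Quotients of modules by submodules *)

Section QuotientModule.
Variables (S : pzRingType) (U : lmodType S) (P : {pred U}).
Hypothesis P_submod : submod_closed P.

(** A named copy of [P], to which the closure hypothesis is attached as an instance. *)
Definition submod_pred : {pred U} := P.

HB.instance Definition _ :=
  GRing.isSubmodClosed.Build S U submod_pred P_submod.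

Definition quotient_module := Quotient.quot submod_pred.

HB.instance Definition _ := GRing.Zmodule.on quotient_module.

Definition quotient_pi (x : U) : quotient_module :=
  \pi_(Quotient.quot submod_pred) x.

Definition quotient_scale (a : S) (x : quotient_module) : quotient_module :=
  quotient_pi (a *: repr x).

Lemma quotient_pi_eq x y : quotient_pi x = quotient_pi y <-> x - y \in P.
Proof.
rewrite (_ : (x - y \in P) = (x - y \in submod_pred)) // Quotient.idealrBE.
by split => /eqP.
Qed.

Lemma quotient_pi_onto x : exists u, x = quotient_pi u.
Proof. by exists (repr x); rewrite /quotient_pi reprK. Qed.

(** Scaling does not depend on the representative, as the submodule is stable under scalars; the
    module axioms then descend from [U]. *)
Lemma quotient_scale_pi a u :
  quotient_scale a (quotient_pi u) = quotient_pi (a *: u).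
Proof.
apply/quotient_pi_eq; rewrite -scalerBr.
apply: (rpredZ (V := U) (s := submod_pred)).
by apply/quotient_pi_eq; rewrite /quotient_pi reprK.
Qed.

Lemma quotient_piD u v : quotient_pi (u + v) = quotient_pi u + quotient_pi v.
Proof. exact: raddfD. Qed.

Lemma quotient_scaleA a b x :
  quotient_scale a (quotient_scale b x) = quotient_scale (a * b) x.
Proof.
by have [u ->] := quotient_pi_onto x; rewrite !quotient_scale_pi scalerA.
Qed.

Lemma quotient_scale1 : left_id 1 quotient_scale.
Proof.
move=> x; have [u ->] := quotient_pi_onto x.
by rewrite quotient_scale_pi scale1r.
Qed.

Lemma quotient_scaleDr : right_distributive quotient_scale +%R.
Proof.
move=> a x y; have [u ->] := quotient_pi_onto x.
have [v ->] := quotient_pi_onto y.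
by rewrite -quotient_piD !quotient_scale_pi scalerDr quotient_piD.
Qed.

Lemma quotient_scaleDl x : {morph quotient_scale^~ x : a b / a + b}.
Proof.
move=> a b; have [u ->] := quotient_pi_onto x.
by rewrite !quotient_scale_pi scalerDl quotient_piD.
Qed.

HB.instance Definition _ := GRing.Zmodule_isLmodule.Build S quotient_module
  quotient_scaleA quotient_scale1 quotient_scaleDr quotient_scaleDl.

Lemma quotient_pi_is_linear : linear quotient_pi.
Proof. by move=> a u v; rewrite quotient_piD -quotient_scale_pi. Qed.

HB.instance Definition _ :=
  GRing.isLinear.Build S U quotient_module _ quotient_pi quotient_pi_is_linear.

End QuotientModule.

(** * From the universal property of direct limits to elements *)

Section DirectLimitElements.
Variables (S : pzRingType) (d : Order.disp_t) (I : preorderType d).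
Hypothesis dirI : directed I.
Variables (V : I -> lmodType S) (L : lmodType S).
Variables (t : forall i j, (i <= j)%O -> {linear V i -> V j}).
Variable (h : forall i, {linear V i -> L}).
Hypothesis sys : direct_system t.
Hypothesis limL : is_direct_limit t h.

Definition limit_image : {pred L} := fun l => `[< exists i x, h i x = l >].

Lemma limit_image_submod_closed : submod_closed limit_image.
Proof.
split=> [|a u v]; rewrite !unfold_in.
  by have [i] := dirI.1; apply/asboolP; exists i, 0; rewrite raddf0.
move=> /asboolP[i [x <-]] /asboolP[j [y <-]]; apply/asboolP.
have [k [ik jk]] := dirI.2 i j; exists k, (a *: t ik x + t jk y).
by rewrite linearP !limL.1.
Qed.

(* The projection of L onto its quotient by the union of the images vanishes on
   every V i, hence is 0 by uniqueness. *)
Lemma limit_onto l : exists i x, h i x = l.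
Proof.
pose k i : {linear V i -> quotient_module limit_image_submod_closed} := \0.
have ck : cocone t k by [].
have [_ /(_ (quotient_pi limit_image_submod_closed) \0) pl] := limL.2 _ _ ck.
have : quotient_pi limit_image_submod_closed l =
       quotient_pi limit_image_submod_closed 0.
  rewrite raddf0; apply: pl => // i x.
  rewrite -[RHS](raddf0 (quotient_pi limit_image_submod_closed)).
  by apply/quotient_pi_eq; rewrite subr0; apply/asboolP; exists i, x.
by move=> /quotient_pi_eq; rewrite subr0 => /asboolP.
Qed.

(* An explicit model of the limit: the free module on the disjoint union of the
   V i, modulo the combinations that eventually evaluate to 0. *)
Definition stage_elt : choiceType := {i : I & (V i : choiceType)}.

(** The value [0] at stages not above the index of [p] is a default, harmless since only late stages
    are consulted. *)
Definition stage_eval (j : I) (p : stage_elt) : V j :=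
  if pselect (tag p <= j)%O is left pj then t pj (tagged p) else 0.

(** Vanishing is required at all stages above some [i], because at a single stage it could come from
    the default value of [stage_eval]. *)
Definition eventually0 : {pred free_mod S stage_elt} := fun u =>
  `[< exists i, forall j, (i <= j)%O -> free_lift (stage_eval j) u = 0 >].

Lemma eventually0_submod_closed : submod_closed eventually0.
Proof.
split=> [|a u v]; rewrite !unfold_in.
  by have [i] := dirI.1; apply/asboolP; exists i => j _; rewrite raddf0.
move=> /asboolP[i ui] /asboolP[j vj]; apply/asboolP.
have [k [ik jk]] := dirI.2 i j; exists k => m km.
have <- : a *: (0 : V m) + 0 = 0 by rewrite scaler0 addr0.
rewrite linearP; congr (a *: _ + _); [apply: ui | apply: vj];
  by [exact: (le_trans ik km) | exact: (le_trans jk km)].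
Qed.

Lemma stage_eval_gen i j (ij : (i <= j)%O) (x : V i) :
  free_lift (stage_eval j) (free_gen S (Tagged V x : stage_elt)) = t ij x.
Proof.
rewrite free_lift_gen /stage_eval; case: pselect => //= ij'.
(* The transition map takes the proof of the inequality as an argument, and [pselect] may return
   another proof than [ij]. *)
by congr (t _ x); exact: Prop_irrelevance.
Qed.

Definition stage_incl i (x : V i) : quotient_module eventually0_submod_closed :=
  quotient_pi eventually0_submod_closed (free_gen S (Tagged V x : stage_elt)).

Lemma stage_incl_is_linear i : linear (@stage_incl i).
Proof.
move=> a x y; rewrite -linearP; apply/quotient_pi_eq/asboolP; exists i => j ij.
rewrite raddfB; apply/eqP; rewrite subr_eq0; apply/eqP.
apply: etrans (stage_eval_gen ij _) _.
by rewrite linearP -!(stage_eval_gen ij); apply/esym/linearP.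
Qed.

HB.instance Definition _ i :=
  GRing.isLinear.Build S (V i) (quotient_module eventually0_submod_closed) _
    (@stage_incl i) (@stage_incl_is_linear i).

Lemma stage_incl_cocone : cocone t (fun i => @stage_incl i).
Proof.
move=> i j ij x; apply/quotient_pi_eq/asboolP; exists j => k jk.
rewrite raddfB; apply/eqP; rewrite subr_eq0; apply/eqP.
apply: etrans (stage_eval_gen jk _) _.
rewrite (sys.2 _ _ _ _ _ (le_trans ij jk)).
exact/esym/stage_eval_gen.
Qed.

(** The universal property maps [L] to the explicit model, so equal images in [L] give equal classes
    there; evaluating the difference of generators at a late stage above [i] yields the
    coincidence. *)
Lemma limit_separated i (x y : V i) :
  h i x = h i y -> exists j (ij : (i <= j)%O), t ij x = t ij y.
Proof.
have [[u uE] _] := limL.2 _ _ stage_incl_cocone.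
move=> /(congr1 u); rewrite !uE => /quotient_pi_eq/asboolP[j xy].
have [k [ik jk]] := dirI.2 i j; exists k, ik.
have /eqP := xy k jk; rewrite raddfB subr_eq0 => /eqP e.
by rewrite -!(stage_eval_gen ik).
Qed.

Lemma direct_limit_filtered_colimit : filtered_colimit t h.
Proof.
split; first exact: sys.2.
- exact: limL.1.
- exact: limit_onto.
- exact: limit_separated.
Qed.

End DirectLimitElements.

Theorem corollary2p10 (R : pzRingType) :
  (forall H : rmodType R, lim_class (@F1fp R) H <-> F1 H) ->
  forall M : lmodType R, F1fpF M <-> F1F M.
Proof.
(* [limF1] presents a module of [F1] as a direct limit of modules of [F1fp]; the other implication
   is the inclusion of [F1fp] in [F1]. *)
move=> limF1 M; split=> [M0 H /limF1|M0 H [/M0]]; last exact.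
move=> [d [I [V [t [h [dirI VF sys lim]]]]]].
have colim := direct_limit_filtered_colimit dirI sys lim.
by apply: (Tor_colimit_eq0 dirI colim) => i; exact: M0.
Qed.
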